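(* Let $k\ge 2$ be a (fixed) integer, and let $p=p(n)$ and $q=q(n)$ satisfy $0\le q\le p\le 1$ and $np\to\infty$ as $n\to\infty$. Then for $G=G_{n,k,p,q}$, and also for $G=G'_{n,k,p,q}$, $$q^*(G)=\frac{(p-q)\,(1-1/k)}{p+(k-1)q}+o(1)\quad\text{whp},$$ and whp the planted partition $\mathcal{A}_0$ has this modularity value, that is, $q_{\mathcal{A}_0}(G)=\frac{(p-q)(1-1/k)}{p+(k-1)q}+o(1)$ whp.
   Context: For a graph $G$ with $m\ge 1$ edges and a vertex partition $\mathcal{A}$, the modularity score is $q_{\mathcal{A}}(G)=\frac1m\sum_{A\in\mathcal{A}}e(A)-\frac1{4m^2}\sum_{A\in\mathcal{A}}\mathrm{vol}(A)^2$, where $e(A)$ is the number of edges inside $A$ and $\mathrm{vol}(A)$ is the sum of the degrees of the vertices in $A$. If $G$ has no edges then $q_{\mathcal{A}}(G)=0$. The modularity is $q^*(G)=\max_{\mathcal{A}}q_{\mathcal{A}}(G)$ over all vertex partitions. Balanced $k$-community stochastic block model on vertex set $[n]$: the vertex set is partitioned into $k$ blocks $V_1,\dots,V_k$, and each possible edge appears independently, with probability $p$ if its ends are in the same block and probability $q$ if they are in different blocks. In $G_{n,k,p,q}$ the blocks are deterministic, each of size $\lfloor n/k\rfloor$ or $\lceil n/k\rceil$. In $G'_{n,k,p,q}$ each vertex independently and uniformly at random picks one of the $k$ blocks to join. The planted partition is $\mathcal{A}_0=\{V_1,\dots,V_k\}$. ''whp'' means with probability tending to 1 as $n\to\infty$;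 ''$X_n=a_n+o(1)$ whp'' means that for every $\delta>0$, $\Pr(|X_n-a_n|\le\delta)\to1$ as $n\to\infty$. *)

(* Defs.v *)
From HB Require Import structures.
From mathcomp Require Import all_boot all_order all_algebra.
From mathcomp Require Import all_classical all_reals all_analysis.
(* Imported last so that [partition], [set0], ... denote the finite-set notions. *)
From mathcomp Require Import finset.
Import Order.TTheory GRing.Theory Num.Theory.
Import numFieldNormedType.Exports.

Set Implicit Arguments.
Unset Strict Implicit.
Unset Printing Implicit Defensive.

Local Open Scope ring_scope.

(* Edges are two-element vertex sets, so graphs are simple. *)
Record sgraph (T : finType) := SGraph {
  edges :> {set {set T}};
  edges_card2 : [forall e in edges, #|e| == 2%N] }.

HB.instance Definition _ (T : finType) := [isSub for @edges T].
HB.instance Definition _ (T : finType) := [Finite of sgraph T by <:].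

Section Modularity.
Variables (R : realType) (T : finType).
Implicit Types (G : sgraph T) (A : {set T}) (P : {set {set T}}).

Definition edges_in G A : nat := #|[set e in edges G | e \subset A]|.

Definition degree G (v : T) : nat := #|[set e in edges G | v \in e]|.

Definition volume G A : nat := (\sum_(v in A) degree G v)%N.

Definition mod_score G P : R :=
  let m : R := #|edges G|%:R in
  if #|edges G| == 0%N then 0
  else m^-1 * (\sum_(A in P) (edges_in G A)%:R)
       - (4 * m ^+ 2)^-1 * (\sum_(A in P) (volume G A)%:R ^+ 2).

(* The maximum is seeded with the one-block partition; see [mod_score_le_modularity]
   and [modularity_attained]. *)
Definition modularity G : R :=
  \big[Num.max/mod_score G [set [set: T]]]_(P | partition P [set: T])
    mod_score G P.

Lemma mod_score_le_modularity G P :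
  partition P [set: T] -> mod_score G P <= modularity G.
Proof. by move=> partP; apply: le_bigmax_cond. Qed.

Lemma modularity_attained G :
  exists2 P, partition P [set: T] & modularity G = mod_score G P.
Proof.
rewrite /modularity; elim/big_ind: _ => [|x y [P hP ->] [Q hQ ->]|P hP].
- have [T0|[v _]] := set_0Vmem [set: T]; last first.
    exists [set [set: T]] => //; apply/and3P; split.
    + by rewrite /cover big_set1.
    + exact: trivIset1.
    + by rewrite inE eq_sym; apply/set0Pn; exists v.
  exists set0; first by rewrite T0 partition_set0.
  suff E0 : #|edges G| == 0%N by rewrite /mod_score E0.
  rewrite cards_eq0; apply/set0Pn => -[e eG].
  have /'forall_implyP/(_ e eG) := edges_card2 G.
  suff -> : e = set0 by rewrite cards0.
  by apply/setP => v; have := in_setT v; rewrite T0 inE.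
- by case: (leP (mod_score G P) (mod_score G Q)); [exists Q | exists P].
- by exists P.
Qed.

End Modularity.

Section BlockModel.
Variables (R : realType) (k : nat) (T : finType).
Implicit Types (c : {ffun T -> 'I_k}) (G : sgraph T) (p q : R).

Definition block c (i : 'I_k) : {set T} := [set v | c v == i].

(* Blocks may be empty, in which case they are dropped to obtain a partition. *)
Definition planted c : {set {set T}} := [set block c i | i : 'I_k] :\ set0.

Lemma plantedP c : partition (planted c) [set: T].
Proof.
apply/and3P; split; last by rewrite !inE eqxx.
- apply/eqP/setP => v; rewrite inE; apply/bigcupP.
  exists (block c (c v)); last by rewrite inE.
  rewrite !inE imset_f // andbT; apply/set0Pn; exists v.
  by rewrite inE.
- apply/trivIsetP => A B /setD1P[_ /imsetP[i _ ->]] /setD1P[_ /imsetP[j _ ->]].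
  move=> neq; rewrite -setI_eq0; apply/eqP/setP => v; rewrite !inE.
  by apply: contra_neqF neq => /andP[/eqP<- /eqP<-].
Qed.

(* [(n + k.-1) %/ k] is n/k rounded up. *)
Definition balanced c : Prop :=
  forall i, #|block c i| = (#|T| %/ k)%N \/
            #|block c i| = ((#|T| + k.-1) %/ k)%N.

Definition edge_prob c p q (e : {set T}) : R :=
  if [exists i, e \subset block c i] then p else q.

Definition sbm c p q G : R :=
  \prod_(e : {set T} | #|e| == 2%N)
    (if e \in edges G then edge_prob c p q e else 1 - edge_prob c p q e).

Definition sbm_unif p q (cG : {ffun T -> 'I_k} * sgraph T) : R :=
  (\prod_(v : T) k%:R^-1) * sbm cG.1 p q cG.2.

Lemma sbm_ge0 c p q G : 0 <= p <= 1 -> 0 <= q <= 1 -> 0 <= sbm c p q G.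
Proof.
move=> /andP[p0 p1] /andP[q0 q1]; apply: prodr_ge0 => e _.
by rewrite /edge_prob; do 2?case: ifP => _ //; rewrite subr_ge0.
Qed.

Lemma sbm_sum1 c p q : \sum_(G : sgraph T) sbm c p q G = 1.
Proof.
pose F (e : {set T}) : R := if #|e| == 2%N then edge_prob c p q e else 0.
pose F' (e : {set T}) : R := if #|e| == 2%N then 1 - edge_prob c p q e else 1.
have : \prod_(e : {set T}) (F e + F' e) = 1.
  by apply: big1 => e _; rewrite /F /F'; case: ifP; rewrite ?add0r // addrC subrK.
rewrite bigA_distr /= => <-.
rewrite (bigID (fun E : {set {set T}} => [forall e in E, #|e| == 2%N])) /=.
rewrite [X in _ = _ + X]big1; last first.
  move=> E /forallPn[e]; rewrite negb_imply => /andP[eE /negbTE e2].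
  by rewrite (bigD1 e) //= eE /F e2 mul0r.
rewrite addr0 (reindex_omap (@edges T) insub) /=; last first.
  by move=> E /= E2; rewrite insubT.
apply: eq_big => [G|G _]; first by rewrite valK eqxx andbT (edges_card2 G).
rewrite /sbm big_mkcond /=; apply: eq_bigr => e _; rewrite /F /F'.
case: ifP => // e2; case: ifP => // eG.
by have /'forall_implyP/(_ e eG) := edges_card2 G; rewrite e2.
Qed.

Lemma sbm_unif_sum1 p q : (0 < k)%N ->
  \sum_(cG : {ffun T -> 'I_k} * sgraph T) sbm_unif p q cG = 1.
Proof.
move=> k0; rewrite -(pair_big xpredT xpredT (fun c G => sbm_unif p q (c, G))) /=.
under eq_bigr => c _ do rewrite -big_distrr /= sbm_sum1 mulr1.
rewrite sumr_const prodr_const card_ffun card_ord.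
by rewrite -[LHS]mulr_natl natrX -exprMn divff ?expr1n // pnatr_eq0 -lt0n.
Qed.

End BlockModel.

Local Open Scope classical_set_scope.

(* [mu n] is the mass function of a law on [Omega n]; X_n = a_n + o(1) whp. *)
Definition whp_approx (R : realType) (Omega : nat -> finType)
    (mu X : forall n, Omega n -> R) (a : nat -> R) : Prop :=
  forall delta : R, 0 < delta ->
    (fun n => \sum_(w : Omega n | `|X n w - a n| <= delta) mu n w)
      @ \oo --> (1 : R).

(* Main.v *)
Require Import Defs.
From mathcomp Require Import all_boot all_order all_algebra.
From mathcomp Require Import all_classical all_reals all_analysis.
(* [partition], [set0], ... are to denote the finite-set notions. *)
From mathcomp Require Import finset.
From mathcomp Require Import ring lra zify.
Import Order.TTheory GRing.Theory Num.Theory.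
Import numFieldNormedType.Exports.

Set Implicit Arguments.
Unset Strict Implicit.
Unset Printing Implicit Defensive.

Local Open Scope ring_scope.

(** Write n for the number of vertices, c for the block assignment, B for the
    n x n matrix with entry p on pairs in the same block and q on the others,
    and M for the adjacency matrix minus its mean (the off-diagonal part of B).

    Concentration.  The score of a partition depends on the graph through the
    sum of the adjacency matrix over the pairs lying in a common part, and
    there are too many partitions for a union bound when np grows slowly.  But
    if the parts receive independent uniform signs and x u is the sign of the
    part of u, then x u * x v has mean 1 when u and v share a part and mean 0
    otherwise, so the sum of M over the common-part pairs is an average of
    quadratic forms x^T M x over sign vectors x
    ([label_sum_le_sign_sum]).  There are only 2^n sign vectors, and for each
    one a Chernoff bound gives |x^T M x| > eps n^2 p with probability
    exp(- Omega(eps^2 n^2 p)), which beats 2^n because np tends to infinity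
    ([high_discrepancy_prob]).  Degrees need no separate argument: applied to
    the partition made of one set and singletons, the same event controls M on
    S x S for every S, hence the sum of all |degree - mean| over the vertices
    ([row_sums_le_sign_sum]).

    Model score.  When the blocks have sizes n/k + O(eps n), replacing the
    adjacency matrix by B and every degree by the common value
    W = n (p + (k-1) q) / k changes every score by O(k eps)
    ([mod_score_near]).  What remains, with s = p + (k-1) q, is
      (p - q) / (s n^2) * sum over common-part pairs of (k [c u = c v] - 1).
    The summand is k-1 on pairs of the same block and negative on the others,
    so the partition into blocks maximises the sum, with value about
    (k-1) n^2 / k; that is the announced limit.  Hence the planted score and
    the modularity are both within 33 k eps of it, deterministically on the
    above event ([mod_score_planted_near], [modularity_near]).

    Random blocks.  Conditionally on the assignment the graph has the law of
    the fixed-block model, and Chebyshev's inequality makes the block sizes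
    n/k + O(eps n) with probability 1 - O(1/n) ([unbalanced_prob]). *)

(** * Random signs *)

Section SignAverage.
Variable R : realType.

(** Orthogonality of the coordinate signs: for a != b, flipping the sign at a
    pairs off the terms. *)
Lemma sum_sign_ffun (S : finType) (a b : S) :
  \sum_(s : {ffun S -> bool}) (-1) ^+ s a * (-1) ^+ s b
    = (a == b)%:R * 2 ^+ #|S| :> R.
Proof.
have [-> | neq] := eqVneq a b.
  under eq_bigr => s _ do rewrite -expr2 sqrr_sign.
  by rewrite sumr_const card_ffun card_bool mul1r natrX.
rewrite mul0r.
pose flip (s : {ffun S -> bool}) := [ffun i => if i == a then ~~ s i else s i].
have flipK : involutive flip.
  by move=> s; apply/ffunP => i; rewrite !ffunE; case: eqP => // _; rewrite negbK.
set x := (X in X = 0); suff : x = - x by move=> h; lra.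
rewrite {1}/x (reindex_inj (inv_inj flipK)) -sumrN; apply: eq_bigr => s _ /=.
by rewrite !ffunE eqxx eq_sym (negbTE neq) signrN mulNr.
Qed.

Variable T : finType.
Implicit Types M : T -> T -> R.

(** Summing M over the pairs with equal labels is averaging its quadratic form
    over signs that are constant on labels.  This replaces a maximum over all
    partitions by one over 2 ^ #|T| sign vectors. *)
Lemma label_sum_le_sign_sum (S : finType) (f : T -> S) M (t : R) :
  (forall x : {ffun T -> bool},
     `|\sum_u \sum_v (-1) ^+ x u * (-1) ^+ x v * M u v| <= t) ->
  `|\sum_u \sum_v (f u == f v)%:R * M u v| <= t.
Proof.
move=> Ht; set X := \sum_u _.
have E : 2 ^+ #|S| * X = \sum_(s : {ffun S -> bool})
    \sum_u \sum_v (-1) ^+ s (f u) * (-1) ^+ s (f v) * M u v.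
  rewrite exchange_big mulr_sumr; apply: eq_bigr => u _ /=.
  rewrite exchange_big mulr_sumr; apply: eq_bigr => v _ /=.
  by rewrite -mulr_suml sum_sign_ffun mulrA [2 ^+ _ * _]mulrC.
have pow_gt0 : 0 < 2 ^+ #|S| :> R by rewrite exprn_gt0.
rewrite -(ler_pM2l pow_gt0) -{1}(gtr0_norm pow_gt0) -normrM E.
apply: le_trans (ler_norm_sum _ _ _) _.
have -> : 2 ^+ #|S| * t = \sum_(s : {ffun S -> bool}) t.
  by rewrite sumr_const card_ffun card_bool -[RHS]mulr_natl natrX.
apply: ler_sum => s _.
have := Ht [ffun u => s (f u)]; congr (`| _ | <= _).
by apply: eq_bigr => u _; apply: eq_bigr => v _; rewrite !ffunE.
Qed.

(** Let S be the set of rows with nonnegative sum.  By symmetry the two mixed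
    blocks cancel, so the sum of the absolute row sums is M(S, S) - M(~S, ~S).
    Each of the two terms is a label sum, for the labelling that makes S (or its
    complement) one class and every other vertex a singleton: singletons
    contribute only diagonal entries, which vanish. *)
Lemma row_sums_le_sign_sum M (t : R) :
  (forall u v, M u v = M v u) -> (forall u, M u u = 0) ->
  (forall x : {ffun T -> bool},
     `|\sum_u \sum_v (-1) ^+ x u * (-1) ^+ x v * M u v| <= t) ->
  \sum_u `|\sum_v M u v| <= 2 * t.
Proof.
move=> symM diagM Ht; pose pos u := 0 <= \sum_v M u v.
have H (b : bool) : `|\sum_u \sum_v ((pos u == b) && (pos v == b))%:R * M u v| <= t.
  have := @label_sum_le_sign_sum _
    (fun u => if pos u == b then None else Some u) M t Ht.
  congr (`| _ | <= _); apply: eq_bigr => u _; apply: eq_bigr => v _.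
  case: (pos u == b); case: (pos v == b) => //=.
  have [/eqP[->]|] := boolP (Some u == Some v); first by rewrite diagM !mulr0.
  by [].
have := H true; have := H false.
rewrite !ler_norml => /andP[h1 _] /andP[_ h2].
suff -> : \sum_u `|\sum_v M u v| =
   \sum_u \sum_v ((pos u == true) && (pos v == true))%:R * M u v -
   \sum_u \sum_v ((pos u == false) && (pos v == false))%:R * M u v by lra.
(* The contribution of the two mixed blocks. *)
pose Y := \sum_u \sum_v ((pos u : nat)%:R - (pos v : nat)%:R) * M u v.
have Y0 : Y = 0.
  suff : Y = - Y by move=> h; lra.
  rewrite {1}/Y exchange_big -sumrN; apply: eq_bigr => u _; rewrite -sumrN.
  by apply: eq_bigr => v _; rewrite (symM v u); ring.
set L := LHS; transitivity (L - Y); first by rewrite Y0 subr0.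
rewrite /L /Y -!sumrB; apply: eq_bigr => u _.
have -> : `|\sum_v M u v| = \sum_v (2 * (pos u : nat)%:R - 1) * M u v.
  rewrite -mulr_sumr; case: (boolP (pos u)) => h /=.
    by rewrite ger0_norm // mulr1n; ring.
  by rewrite ltr0_norm ?ltNge // mulr0n; ring.
rewrite -!sumrB; apply: eq_bigr => v _.
by case: (pos u); case: (pos v) => /=; rewrite ?mulr1n ?mulr0n; ring.
Qed.

End SignAverage.

(** * The score as a sum over pairs of vertices *)

Section Adjacency.
Variables (R : realType) (T : finType).
Implicit Types (G : sgraph T) (A : {set T}).

Lemma sum_pairs_set2 (F : {set T} -> R) :
  \sum_u \sum_(v | u != v) F [set u; v] = 2 * \sum_(e : {set T} | #|e| == 2%N) F e.
Proof.
rewrite pair_big_dep /=.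
rewrite (partition_big (fun w : T * T => [set w.1; w.2]) (fun e => #|e| == 2%N)) /=;
  last first.
  by case=> u v /= uv; rewrite cards2 uv.
rewrite mulr_sumr; apply: eq_bigr => e /cards2P[a [b [ab ->]]].
rewrite (eq_bigl (fun w => (w == (a, b)) || (w == (b, a)))); last first.
  case=> u v /=; rewrite !xpair_eqE; apply/andP/idP.
    move=> [uv /eqP E].
    have : u \in [set a; b] by rewrite -E !inE eqxx.
    have : v \in [set a; b] by rewrite -E !inE eqxx orbT.
    by rewrite !inE => /orP[] /eqP Ev /orP[] /eqP Eu; move: uv;
      rewrite Ev Eu ?eqxx ?orbT.
  move=> /orP[] /andP[/eqP-> /eqP->]; split=> //; first by rewrite eq_sym.
  by rewrite setUC.
rewrite (bigD1 (a, b)) /= ?eqxx // (big_pred1 (b, a)) /=; last first.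
  move=> w /=; have [->|_] /= := eqVneq w (a, b); last by rewrite andbT.
  by rewrite xpair_eqE (negbTE ab).
by rewrite [[set b; a]]setUC; ring.
Qed.

Definition adj G u v : R := ([set u; v] \in edges G)%:R.

Lemma adjC G u v : adj G u v = adj G v u.
Proof. by rewrite /adj setUC. Qed.

Lemma card_edge G e : e \in edges G -> #|e| = 2%N.
Proof. by move=> eG; have /'forall_implyP/(_ e eG)/eqP := edges_card2 G. Qed.

Lemma adj_diag G u : adj G u u = 0.
Proof.
rewrite /adj; case: (boolP (_ \in _)) => // /card_edge.
by rewrite cards2 eqxx.
Qed.

Lemma edges_in_adj G A :
  2 * (edges_in G A)%:R = \sum_(u in A) \sum_(v in A) adj G u v :> R.
Proof.
have -> : (edges_in G A)%:R =
    \sum_(e : {set T} | #|e| == 2%N) ((e \in edges G) && (e \subset A))%:R :> R.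
  rewrite /edges_in -sum1_card natr_sum big_mkcond /= [RHS]big_mkcond /=.
  apply: eq_bigr => e _; rewrite inE; have [eG|] := boolP (e \in edges G).
    by rewrite (card_edge eG) /=; case: (e \subset A).
  by rewrite /= if_same.
rewrite -sum_pairs_set2 [RHS]big_mkcond /=; apply: eq_bigr => u _.
rewrite big_mkcond /=; have [uA|uA] := boolP (u \in A); last first.
  by apply: big1 => v _; rewrite subUset sub1set (negbTE uA) /= andbF if_same.
rewrite [RHS]big_mkcond /=; apply: eq_bigr => v _.
rewrite subUset !sub1set uA /=; have [<-|uv] := eqVneq u v.
  by rewrite adj_diag if_same.
by case: (v \in A); rewrite ?andbT ?andbF.
Qed.

Lemma edges_adj G : 2 * #|edges G|%:R = \sum_u \sum_v adj G u v :> R.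
Proof.
have := edges_in_adj G setT.
rewrite /edges_in; have -> : [set e in edges G | e \subset [set: T]] = edges G.
  by apply/setP => e; rewrite inE subsetT andbT.
by move->; apply: eq_big => [u|u _]; rewrite ?inE //; apply: eq_bigl => v; rewrite inE.
Qed.

Lemma degree_adj G v : (degree G v)%:R = \sum_u adj G v u.
Proof.
have E : [set e in edges G | v \in e] =
    (fun u => [set v; u]) @: [set u | [set v; u] \in edges G].
  apply/setP => e; rewrite inE; apply/andP/imsetP.
    move=> [eG ve]; have /eqP/cards2P[a [b [ab Ee]]] := card_edge eG.
    move: ve; rewrite Ee !inE => /orP[] /eqP ->.
      by exists b => //; rewrite inE -Ee.
    by exists a; rewrite ?inE setUC // -Ee.
  by move=> [u]; rewrite inE => uG ->; rewrite uG !inE eqxx.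
rewrite /degree E card_in_imset.
  rewrite -sum1_card natr_sum big_mkcond /=; apply: eq_bigr => u _.
  by rewrite inE /adj; case: ifP.
move=> u w; rewrite !inE => /card_edge; rewrite cards2 => uv _ Euw.
have : u \in [set v; w] by rewrite -Euw !inE eqxx orbT.
by rewrite !inE => /orP[/eqP Eu|/eqP//]; move: uv; rewrite Eu eqxx.
Qed.

Lemma sum_degree G : \sum_v (degree G v)%:R = 2 * #|edges G|%:R :> R.
Proof. by rewrite edges_adj; apply: eq_bigr => v _; rewrite degree_adj. Qed.

Lemma sum_partition_pblock (P : {set {set T}}) (F : T -> T -> R) :
  partition P [set: T] ->
  \sum_(A in P) \sum_(u in A) \sum_(v in A) F u v =
  \sum_u \sum_v (pblock P u == pblock P v)%:R * F u v.
Proof.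
move=> partP; have /and3P[/eqP covP trivP _] := partP.
have inP u : u \in cover P by rewrite covP inE.
transitivity (\sum_(A in P) \sum_(u in A)
                \sum_v (pblock P u == pblock P v)%:R * F u v).
  apply: eq_bigr => A AP; apply: eq_bigr => u uA; rewrite big_mkcond.
  apply: eq_bigr => v _; rewrite (def_pblock trivP AP uA).
  have -> : (A == pblock P v) = (v \in A).
    apply/eqP/idP => [->|vA]; first by rewrite mem_pblock.
    by rewrite (def_pblock trivP AP vA).
  by case: ifP; rewrite ?mul1r ?mul0r.
rewrite -(@big_trivIset _ _ _ _ P
  (fun u => \sum_v (pblock P u == pblock P v)%:R * F u v)) //.
by apply: eq_bigl => u; rewrite inP.
Qed.

(** Both terms of the score become sums over ordered pairs with equal labels,
    the label of a vertex being its part; from here on partitions only enter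
    through such labellings. *)
Lemma mod_score_adj G (P : {set {set T}}) (m2 := 2 * #|edges G|%:R : R) :
  partition P [set: T] -> 0 < m2 ->
  mod_score R G P =
    (\sum_u \sum_v (pblock P u == pblock P v)%:R * adj G u v) / m2 -
    (\sum_u \sum_v (pblock P u == pblock P v)%:R *
        ((degree G u)%:R * (degree G v)%:R)) / m2 ^+ 2.
Proof.
move=> partP m2_gt0; rewrite /mod_score ifF; last first.
  by apply/negbTE/eqP => E; move: m2_gt0; rewrite /m2 E mulr0 ltxx.
rewrite -!(sum_partition_pblock _ partP).
under [in RHS]eq_bigr => A _ do rewrite -edges_in_adj.
rewrite -mulr_sumr.
under [X in _ = _ - X / _]eq_bigr => A _.
  under eq_bigr => u _ do rewrite -mulr_sumr.
  rewrite -mulr_suml -expr2 -natr_sum -/(volume G A); over.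
have m_neq0 : #|edges G|%:R != 0 :> R.
  by apply: contraTneq m2_gt0; rewrite /m2 => ->; rewrite mulr0 ltxx.
rewrite /m2; field.
by [].
Qed.

End Adjacency.

(** * Deterministic estimates *)

(** Perturbation of the score X / m2 - Y / m2 ^+ 2 when twice the edge number m2
    is replaced by mu, the edge term X by B and the volume term Y by Z, all
    relative errors being at most theta. *)
Lemma ratio_near (R : realType) (X Y m2 B Z mu theta : R) :
  0 < mu -> 0 <= theta <= 2^-1 -> 0 <= X <= m2 -> 0 <= Y <= m2 ^+ 2 ->
  `|m2 - mu| <= theta * mu -> `|X - B| <= theta * mu ->
  `|Y - Z| <= theta * mu * (m2 + mu) ->
  0 < m2 /\ `|X / m2 - Y / m2 ^+ 2 - (B / mu - Z / mu ^+ 2)| <= 8 * theta.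
Proof.
move=> mu0 /andP[th0 th1] /andP[X0 X1] /andP[Y0 Y1] dm dX dY.
have m2_gt0 : 0 < m2.
  move: dm; rewrite ler_norml => /andP[h _].
  have : theta * mu <= 2^-1 * mu by rewrite ler_wpM2r // ltW.
  lra.
split=> //.
pose a := X / m2; pose b := Y / m2 ^+ 2; pose r := m2 / mu.
have a01 : 0 <= a <= 1.
  by rewrite /a divr_ge0 ?(ltW m2_gt0) //= ler_pdivrMr // mul1r.
have b01 : 0 <= b <= 1.
  by rewrite /b divr_ge0 ?sqr_ge0 //= ler_pdivrMr ?exprn_gt0 // mul1r.
have dr : `|r - 1| <= theta.
  have -> : r - 1 = (m2 - mu) / mu by rewrite /r; field; rewrite gt_eqF.
  by rewrite normrM normfV (gtr0_norm mu0) ler_pdivrMr.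
have dar : `|a * r - B / mu| <= theta.
  have -> : a * r - B / mu = (X - B) / mu.
    by rewrite /r /a; field; rewrite !gt_eqF.
  by rewrite normrM normfV (gtr0_norm mu0) ler_pdivrMr.
have dbr : `|b * r ^+ 2 - Z / mu ^+ 2| <= theta * (r + 1).
  have -> : b * r ^+ 2 - Z / mu ^+ 2 = (Y - Z) / mu ^+ 2.
    by rewrite /r /b; field; rewrite !gt_eqF.
  rewrite normrM normfV [`|mu ^+ 2|]gtr0_norm ?exprn_gt0 // ler_pdivrMr ?exprn_gt0 //.
  suff -> : theta * (r + 1) * mu ^+ 2 = theta * mu * (m2 + mu) by [].
  by rewrite /r; field; rewrite gt_eqF.
rewrite -/a -/b.
move: a01 b01 dr dar dbr; rewrite !ler_norml.
move: (a) (b) (r) (B / mu) (Z / mu ^+ 2) => {}a {}b {}r B' Z'.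
move=> /andP[a0 a1] /andP[b0 b1] /andP[r0 r1] /andP[h1 h2] /andP[h3 h4].
have r2 : `|r ^+ 2 - 1| <= 5 / 2 * theta.
  have -> : r ^+ 2 - 1 = (r + 1) * (r - 1) by ring.
  rewrite normrM ler_pM // ler_norml; apply/andP; split; lra.
have ar : `|a * (r - 1)| <= 1 * theta.
  by rewrite normrM ler_pM // ler_norml; apply/andP; split; lra.
have br : `|b * (r ^+ 2 - 1)| <= 1 * (5 / 2 * theta).
  by rewrite normrM ler_pM // ler_norml; apply/andP; split; lra.
have tr : theta * (r + 1) <= 5 / 2 * theta.
  by rewrite mulrC ler_wpM2r //; lra.
move: ar br; rewrite !ler_norml !mulrBr !mulr1 => /andP[? ?] /andP[? ?].
by apply/andP; split; lra.
Qed.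

Section Deterministic.
Variables (R : realType) (T : finType) (k : nat).
Implicit Types (G : sgraph T) (c : {ffun T -> 'I_k}) (p q eps : R).

Definition pair_prob c p q u v : R := if c u == c v then p else q.

Definition noise c p q G u v : R :=
  adj R G u v - (u != v)%:R * pair_prob c p q u v.

Definition low_discrepancy c p q G (t : R) : bool :=
  [forall x : {ffun T -> bool},
    `|\sum_u \sum_v (-1) ^+ x u * (-1) ^+ x v * noise c p q G u v| <= t].

Definition near_balanced c eps : bool :=
  [forall i, `|#|block c i|%:R - #|T|%:R / k%:R| <= eps * #|T|%:R].

Lemma pair_probC c p q u v : pair_prob c p q u v = pair_prob c p q v u.
Proof. by rewrite /pair_prob eq_sym. Qed.

Lemma noiseC c p q G u v : noise c p q G u v = noise c p q G v u.
Proof. by rewrite /noise adjC pair_probC eq_sym. Qed.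

Lemma noise_diag c p q G u : noise c p q G u u = 0.
Proof. by rewrite /noise adj_diag eqxx mul0r subr0. Qed.

Lemma sum_same_color c u : \sum_v (c u == c v)%:R = #|block c (c u)|%:R :> R.
Proof.
rewrite -sum1_card natr_sum [RHS]big_mkcond /=; apply: eq_bigr => v _.
by rewrite inE eq_sym; case: ifP.
Qed.

Lemma pair_probE c p q u v : pair_prob c p q u v = q + (p - q) * (c u == c v)%:R.
Proof.
by rewrite /pair_prob; case: ifP => _; rewrite ?mulr1 ?mulr0 ?addr0 // addrC subrK.
Qed.

Lemma sum_pair_prob c p q u :
  \sum_v pair_prob c p q u v = q * #|T|%:R + (p - q) * #|block c (c u)|%:R.
Proof.
under eq_bigr => v _ do rewrite pair_probE.
rewrite big_split /= sumr_const -mulr_sumr sum_same_color.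
by rewrite -[q *+ _]mulr_natr.
Qed.

(** The mean degree omits the diagonal entry of the probability matrix, which
    is p. *)
Lemma degree_noise c p q G u :
  (degree G u)%:R = \sum_v noise c p q G u v - p + \sum_v pair_prob c p q u v.
Proof.
rewrite degree_adj /noise sumrB.
suff -> : \sum_v (u != v)%:R * pair_prob c p q u v =
    \sum_v pair_prob c p q u v - p by ring.
rewrite (bigD1 u) //= eqxx mul0r add0r [in RHS](bigD1 u) //=.
rewrite {2}/pair_prob eqxx [RHS]addrC addKr; apply: eq_bigr => v.
by rewrite eq_sym => ->; rewrite mul1r.
Qed.

Lemma pblock_planted c u v :
  (pblock (planted c) u == pblock (planted c) v) = (c u == c v).
Proof.
have /and3P[_ trivP _] := plantedP c.
have E w : pblock (planted c) w = block c (c w).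
  apply: (def_pblock trivP); last by rewrite inE.
  by rewrite !inE imset_f // andbT; apply/set0Pn; exists w; rewrite inE.
rewrite !E; apply/eqP/eqP => [/setP/(_ u)|-> //].
by rewrite !inE eqxx => /esym/eqP.
Qed.

Section Estimates.
Variables (c : {ffun T -> 'I_k}) (p q eps : R) (G : sgraph T).
Local Notation n := (#|T|%:R : R).
Local Notation kR := (k%:R : R).
Hypotheses (k_gt0 : (0 < k)%N) (p_gt0 : 0 < p) (q_ge0 : 0 <= q) (qp : q <= p).
Hypothesis discG : low_discrepancy c p q G (eps * n ^+ 2 * p).
Hypothesis nearc : near_balanced c eps.
Hypothesis epsn : 1 <= eps * n.

Let disc x : `|\sum_u \sum_v (-1) ^+ (x : {ffun T -> bool}) u * (-1) ^+ x v *
  noise c p q G u v| <= eps * n ^+ 2 * p.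
Proof. by have /forallP/(_ x) := discG. Qed.

Let near i : `|#|block c i|%:R - n / kR| <= eps * n.
Proof. by have /forallP/(_ i) := nearc. Qed.

Let kR_gt0 : 0 < kR. Proof. by rewrite ltr0n. Qed.

(* W is the mean degree for blocks of size exactly n / k (self-pairs included);
   tau bounds all the additive errors below. *)
Let s := p + (kR - 1) * q.
Let W := n * s / kR.
Let tau := 4 * eps * n ^+ 2 * p.

Let n_gt0 : 0 < n.
Proof.
rewrite lt_neqAle ler0n andbT; apply: contraTneq epsn => <-.
by rewrite mulr0 ler10.
Qed.

Let eps_gt0 : 0 < eps.
Proof. by rewrite -(pmulr_lgt0 _ n_gt0) (lt_le_trans ltr01). Qed.

Let s_gt0 : 0 < s.
Proof. by rewrite /s ltr_wpDr // mulr_ge0 // subr_ge0 ler1n. Qed.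

Let np_le : n * p <= eps * n ^+ 2 * p.
Proof.
rewrite ler_pM2r // expr2 mulrA -{1}[n]mul1r ler_wpM2r //.
Qed.

(** Three errors, each at most a multiple of eps n^2 p: the random part (2 eps),
    the missing diagonal (eps, as 1 <= eps n), and the deviation of the block
    sizes from n / k (eps). *)
Lemma sum_degree_dev : \sum_u `|(degree G u)%:R - W| <= tau.
Proof.
have H u : `|(degree G u)%:R - W| <=
    `|\sum_v noise c p q G u v| + (p + p * (eps * n)).
  rewrite (degree_noise c p q) sum_pair_prob.
  have -> : \sum_v noise c p q G u v - p +
      (q * n + (p - q) * #|block c (c u)|%:R) - W =
      \sum_v noise c p q G u v +
      (- p + (p - q) * (#|block c (c u)|%:R - n / kR)).
    by rewrite /W /s; field; rewrite gt_eqF.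
  apply: le_trans (ler_normD _ _) _; rewrite lerD2l.
  apply: le_trans (ler_normD _ _) _; rewrite normrN (gtr0_norm p_gt0) lerD2l.
  rewrite normrM; apply: ler_pM => //.
  by rewrite ger0_norm ?subr_ge0 // gerBl.
apply: le_trans (ler_sum _ (fun u _ => H u)) _.
rewrite big_split /= sumr_const -[_ *+ #|T|]mulr_natr.
have := @row_sums_le_sign_sum R T _ _ (noiseC c p q G) (noise_diag c p q G) disc.
move=> h; have -> : tau = 2 * (eps * n ^+ 2 * p) + (eps * n ^+ 2 * p + p * (eps * n) * n).
  by rewrite /tau; ring.
apply: lerD; first exact: h.
rewrite mulrDl lerD2r [p * _]mulrC.

exact: np_le.
Qed.

Lemma sum_degree_near : `|2 * #|edges G|%:R - n * W| <= tau.
Proof.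
rewrite -sum_degree.
have -> : n * W = \sum_(u : T) W by rewrite sumr_const -[RHS]mulr_natl.
by rewrite -sumrB; apply: le_trans (ler_norm_sum _ _ _) sum_degree_dev.
Qed.

Section Labels.
Variables (S : finType) (f : T -> S).
Let X := \sum_u \sum_v (f u == f v)%:R * adj R G u v.
Let Y := \sum_u \sum_v (f u == f v)%:R * ((degree G u)%:R * (degree G v)%:R : R).
Let B := \sum_u \sum_v (f u == f v)%:R * pair_prob c p q u v.
Let Z := \sum_u \sum_v (f u == f v)%:R : R.

Lemma label_adj_near : `|X - B| <= tau.
Proof.
have -> : X - B = \sum_u \sum_v (f u == f v)%:R * noise c p q G u v -
    \sum_(u : T) p.
  rewrite /X /B -!sumrB; apply: eq_bigr => u _; rewrite -sumrB.
  have Ep : p = \sum_v (u == v)%:R * p.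
    rewrite (bigD1 u) //= eqxx mul1r big1 ?addr0 // => v.
    by rewrite eq_sym => /negbTE ->; rewrite mul0r.
  rewrite [X in _ - X]Ep -sumrB; apply: eq_bigr => v _; rewrite /noise.
  have [<-|_] /= := eqVneq u v; last first.
    by rewrite mul1r mul0r subr0 mulrBr.
  by rewrite /pair_prob !eqxx !mul0r !mul1r subr0.
rewrite sumr_const -[p *+ _]mulr_natl.
have := label_sum_le_sign_sum f disc.
set A := \sum_u _; move=> h.
apply: le_trans (ler_normB _ _) _.
rewrite [X in _ + X]ger0_norm ?mulr_ge0 ?(ltW p_gt0) //.
rewrite /tau; have h1 : 0 <= eps * n ^+ 2 * p by apply: le_trans (normr_ge0 _) h.
have h2 := np_le; lra.
Qed.

(** Replacing the two degrees one at a time costs one L1 degree deviation each,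
    whatever the labelling. *)
Lemma label_volume_near :
  `|Y - W ^+ 2 * Z| <= tau * (2 * #|edges G|%:R + n * W).
Proof.
have W_ge0 : 0 <= W.
  by rewrite /W /s divr_ge0 // mulr_ge0 // addr_ge0 ?(ltW p_gt0) // mulr_ge0 //
    subr_ge0 ler1n.
pose D (u : T) : R := (degree G u)%:R; pose dev u := `|D u - W|.
have sumdev : \sum_u dev u <= tau by apply: sum_degree_dev.
apply: (@le_trans _ _ (\sum_u \sum_v (dev u * D v + W * dev v))).
  rewrite /Y /Z mulr_sumr -sumrB; apply: le_trans (ler_norm_sum _ _ _) _.
  apply: ler_sum => u _; rewrite mulr_sumr -sumrB.
  apply: le_trans (ler_norm_sum _ _ _) _; apply: ler_sum => v _.
  have : `|D u * D v - W ^+ 2| <= dev u * D v + W * dev v.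
    have -> : D u * D v - W ^+ 2 = (D u - W) * D v + W * (D v - W) by ring.
    apply: le_trans (ler_normD _ _) _; rewrite [`|W * _|]normrM [`|_ * D v|]normrM.
    by rewrite (ger0_norm W_ge0) [`|D v|]ger0_norm.
  case: eqP => _; rewrite ?mul1r ?mulr1 // !mul0r mulr0 subr0 normr0 => _.
  by apply: addr_ge0; apply: mulr_ge0; rewrite ?ler0n ?normr_ge0.
under eq_bigr => u _.
  rewrite big_split /= -!mulr_sumr; over.
rewrite big_split /= -mulr_suml sumr_const -[_ *+ _]mulr_natl.
rewrite /D sum_degree mulrDr lerD //; first by rewrite ler_wpM2r // mulr_ge0.
by rewrite mulrA mulrC ler_wpM2r // mulr_ge0.
Qed.

Lemma label_adj_le : 0 <= X <= 2 * #|edges G|%:R.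
Proof.
rewrite edges_adj; apply/andP; split.
  by apply: sumr_ge0 => u _; apply: sumr_ge0 => v _; rewrite mulr_ge0.
apply: ler_sum => u _; apply: ler_sum => v _; rewrite -[leRHS]mul1r ler_wpM2r //.
by case: eqP.
Qed.

Lemma label_volume_le : 0 <= Y <= (2 * #|edges G|%:R) ^+ 2.
Proof.
rewrite expr2 -sum_degree; apply/andP; split.
  by apply: sumr_ge0 => u _; apply: sumr_ge0 => v _; rewrite !mulr_ge0.
rewrite mulr_suml.
apply: ler_sum => u _; rewrite mulr_sumr; apply: ler_sum => v _.
by rewrite -[leRHS]mul1r ler_wpM2r ?mulr_ge0 //; case: eqP.
Qed.

(** Write the pair probabilities as q + (p - q) [c u = c v].  As n W = n^2 s / k,
    the number Z of pairs with equal labels gets the coefficient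
    (k q / s - 1) / n^2 = - (p - q) / (s n^2), where the 1 comes from the
    volume term. *)
Lemma model_score :
  B / (n * W) - W ^+ 2 * Z / (n * W) ^+ 2 =
  (p - q) / (s * n ^+ 2) *
    (\sum_u \sum_v (f u == f v)%:R * (kR * (c u == c v)%:R - 1)).
Proof.
pose C : R := \sum_u \sum_v (f u == f v)%:R * (c u == c v)%:R.
have -> : B = q * Z + (p - q) * C.
  rewrite /B /Z /C !mulr_sumr -big_split; apply: eq_bigr => u _ /=.
  rewrite !mulr_sumr -big_split; apply: eq_bigr => v _ /=.
  by rewrite pair_probE; ring.
have -> : \sum_u \sum_v (f u == f v)%:R * (kR * (c u == c v)%:R - 1) =
    kR * C - Z.
  rewrite /Z /C !mulr_sumr -sumrB; apply: eq_bigr => u _ /=.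
  rewrite !mulr_sumr -sumrB; apply: eq_bigr => v _ /=; ring.
have n0 := n_gt0; have s0 := s_gt0.
move: C Z => C' Z'; rewrite /W /s; field.
by rewrite -/s !gt_eqF.
Qed.

End Labels.

Hypothesis eps_small : 8 * kR * eps <= 1.

Let k_ge1 : 1 <= kR. Proof. by rewrite ler1n. Qed.

(** The relative error is theta = 4 k eps, since n W = n^2 s / k is at least
    n^2 p / k; the constant 32 is 8 * 4. *)
Lemma mod_score_near (P : {set {set T}}) : partition P [set: T] ->
  `|mod_score R G P - (p - q) / (s * n ^+ 2) *
    (\sum_u \sum_v (pblock P u == pblock P v)%:R * (kR * (c u == c v)%:R - 1))|
  <= 32 * kR * eps.
Proof.
move=> partP; rewrite -(model_score (pblock P)).
have n0 := n_gt0; have s0 := s_gt0; have W0 : 0 < W by rewrite divr_gt0 // mulr_gt0.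
have eps0 := eps_gt0.
have ps : p <= s by rewrite /s lerDl mulr_ge0 // subr_ge0.
have tau_le : tau <= 4 * kR * eps * (n * W).
  have -> : 4 * kR * eps * (n * W) = 4 * eps * n ^+ 2 * s.
    by rewrite /W; field; rewrite gt_eqF.
  by rewrite /tau ler_wpM2l // !mulr_ge0 // ltW.
have [|||||m0] := @ratio_near R _ _ (2 * #|edges G|%:R)
    (\sum_u \sum_v (pblock P u == pblock P v)%:R * pair_prob c p q u v)
    (W ^+ 2 * (\sum_u \sum_v (pblock P u == pblock P v)%:R)) (n * W)
    (4 * kR * eps) _ _ (label_adj_le (pblock P)) (label_volume_le (pblock P)).
- exact: mulr_gt0.
- have es := eps_small; rewrite !mulr_ge0 ?(ltW eps0) //=; lra.
- exact: le_trans sum_degree_near tau_le.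
- exact: le_trans (label_adj_near _) tau_le.
- apply: le_trans (label_volume_near _) _; rewrite ler_wpM2r //.
  by rewrite addr_ge0 // ?mulr_ge0 // ltW.
rewrite (mod_score_adj partP m0) => h; apply: le_trans h _; lra.
Qed.

(** The number of ordered pairs inside blocks is the sum over u of the size of
    the block of u, hence n^2 / k up to eps n^2. *)
Lemma planted_value_near :
  `|(p - q) / (s * n ^+ 2) * (\sum_u \sum_v (kR - 1) * (c u == c v)%:R) -
    (p - q) * (1 - kR^-1) / s| <= kR * eps.
Proof.
have n0 := n_gt0; have s0 := s_gt0; have eps0 := eps_gt0.
have ps : p <= s by rewrite /s lerDl mulr_ge0 // subr_ge0.
under eq_bigr => u _ do rewrite -mulr_sumr sum_same_color.
rewrite -mulr_sumr.
set C := \sum_u _.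
have dC : `|C - n ^+ 2 / kR| <= eps * n ^+ 2.
  have -> : C - n ^+ 2 / kR = \sum_(u : T) (#|block c (c u)|%:R - n / kR).
    rewrite sumrB sumr_const -[X in _ = _ - X]mulr_natl; congr (_ - _); ring.
  apply: le_trans (ler_norm_sum _ _ _) _.
  apply: le_trans (ler_sum _ (fun u _ => near (c u))) _.
  by rewrite sumr_const -[leLHS]mulr_natl le_eqVlt; apply/orP; left; apply/eqP; ring.
have -> : (p - q) / (s * n ^+ 2) * ((kR - 1) * C) - (p - q) * (1 - kR^-1) / s
   = (p - q) / s * (kR - 1) * ((C - n ^+ 2 / kR) / n ^+ 2).
  by field; rewrite !gt_eqF.
have h1 : `|(p - q) / s * (kR - 1)| <= 1 * kR.
  rewrite normrM ler_pM // ger0_norm ?subr_ge0 // ?gerBl //.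
    by rewrite ler_pdivrMr // mul1r (le_trans _ ps) // gerBl.
  by rewrite divr_ge0 ?subr_ge0 // ltW.
apply: (@le_trans _ _ (1 * kR * eps)); last by rewrite mul1r.
rewrite normrM ler_pM // normrM normfV [`|n ^+ 2|]gtr0_norm ?exprn_gt0 //.
by rewrite ler_pdivrMr // exprn_gt0.
Qed.

Lemma mod_score_planted_near :
  `|mod_score R G (planted c) - (p - q) * (1 - kR^-1) / s| <= 33 * kR * eps.
Proof.
have := mod_score_near (plantedP c).
have -> : \sum_u \sum_v (pblock (planted c) u == pblock (planted c) v)%:R *
      (kR * (c u == c v)%:R - 1) = \sum_u \sum_v (kR - 1) * (c u == c v)%:R.
  apply: eq_bigr => u _; apply: eq_bigr => v _; rewrite pblock_planted.
  by case: (c u == c v); rewrite ?mulr1 ?mul1r ?mul0r ?mulr0.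
have := planted_value_near.
set V := _ * \sum_u _; set a := _ / s.
rewrite !ler_norml => /andP[? ?] /andP[? ?]; apply/andP; split; lra.
Qed.

(** The planted labelling dominates termwise: k [c u = c v] - 1 is k - 1 on pairs
    of the same block, and at most 0 on the others. *)
Lemma mod_score_upper (P : {set {set T}}) : partition P [set: T] ->
  mod_score R G P <= (p - q) * (1 - kR^-1) / s + 33 * kR * eps.
Proof.
move=> partP; have := mod_score_near partP; have := planted_value_near.
have n0 := n_gt0; have s0 := s_gt0.
have : (p - q) / (s * n ^+ 2) *
    (\sum_u \sum_v (pblock P u == pblock P v)%:R * (kR * (c u == c v)%:R - 1))
  <= (p - q) / (s * n ^+ 2) * (\sum_u \sum_v (kR - 1) * (c u == c v)%:R).
  rewrite ler_wpM2l ?divr_ge0 ?subr_ge0 ?mulr_ge0 ?(ltW s0) //.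
  apply: ler_sum => u _; apply: ler_sum => v _; have k1 := k_ge1.
  case: (pblock P u == pblock P v); case: (c u == c v);
    rewrite ?mul1r ?mul0r ?mulr1 ?mulr0 //; lra.
set V := _ * \sum_u _; set V' := _ * \sum_u _; set a := _ / s.
rewrite !ler_norml => ? /andP[? ?] /andP[? ?]; lra.
Qed.

Lemma modularity_near :
  `|modularity R G - (p - q) * (1 - kR^-1) / s| <= 33 * kR * eps.
Proof.
have [P partP E] := modularity_attained R G.
have h1 := mod_score_upper partP; rewrite -E in h1.
have h2 := mod_score_le_modularity R G (plantedP c).
have := mod_score_planted_near; rewrite !ler_norml => /andP[? ?].
apply/andP; split; lra.
Qed.

End Estimates.

End Deterministic.

(** * Concentration over all sign vectors *)

Lemma sum_exists_le (R : realType) (I J : finType) (m : I -> R) (Q : J -> pred I) :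
  (forall i, 0 <= m i) ->
  \sum_(i | [exists j, Q j i]) m i <= \sum_j \sum_(i | Q j i) m i.
Proof.
move=> m_ge0; under [leRHS]eq_bigr => j _ do rewrite big_mkcond /=.
rewrite exchange_big big_mkcond /=; apply: ler_sum => i _.
have ge0 (P : pred J) : 0 <= \sum_(j | P j) (if Q j i then m i else 0).
  by apply: sumr_ge0 => j _; case: ifP.
case: ifP => [/existsP[j Qji]|_]; last exact: ge0.
by rewrite (bigD1 j) //= Qji lerDl ge0.
Qed.

Lemma ler_sum_subset (R : realType) (I : finType) (m : I -> R) (P Q : pred I) :
  (forall i, 0 <= m i) -> (forall i, P i -> Q i) ->
  \sum_(i | P i) m i <= \sum_(i | Q i) m i.
Proof.
move=> m_ge0 PQ; rewrite big_mkcond [leRHS]big_mkcond; apply: ler_sum => i _.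
by have := PQ i; case: (P i) => [->//|_]; case: ifP.
Qed.

Section Chernoff.
Variables (R : realType) (T : finType) (k : nat).
Implicit Types (G : sgraph T) (c : {ffun T -> 'I_k}) (p q eps : R).
Local Notation n := (#|T|%:R : R).

(** Independence of the edges, in the form used for moment generating
    functions: expand the product of sums over the edge sets. *)
Lemma sbm_expect_prod c p q (phi : {set T} -> bool -> R) :
  \sum_(G : sgraph T) sbm c p q G *
      \prod_(e : {set T} | #|e| == 2%N) phi e (e \in edges G) =
  \prod_(e : {set T} | #|e| == 2%N)
    (edge_prob c p q e * phi e true + (1 - edge_prob c p q e) * phi e false).
Proof.
pose F (e : {set T}) : R :=
  if #|e| == 2%N then edge_prob c p q e * phi e true else 0.
pose F' (e : {set T}) : R :=
  if #|e| == 2%N then (1 - edge_prob c p q e) * phi e false else 1.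
transitivity (\prod_(e : {set T}) (F e + F' e)); last first.
  rewrite [RHS]big_mkcond; apply: eq_bigr => e _.
  by rewrite /F /F'; case: ifP => // _; rewrite add0r.
rewrite bigA_distr.
rewrite (bigID (fun E : {set {set T}} => [forall e in E, #|e| == 2%N])) /=.
rewrite [X in _ = _ + X]big1 ?addr0; last first.
  move=> E /forallPn[e]; rewrite negb_imply => /andP[eE /negbTE e2].
  by rewrite (bigD1 e) //= eE /F e2 mul0r.
rewrite [RHS](reindex_omap (@edges T) insub) /=; last first.
  by move=> E /= E2; rewrite insubT.
apply: eq_big => [G|G _]; first by rewrite valK eqxx andbT (edges_card2 G).
rewrite /sbm -big_split big_mkcond /=; apply: eq_bigr => e _; rewrite /F /F'.
case: ifP => [_|e2]; first by case: ifP.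
by case: ifP => // /card_edge /eqP; rewrite e2.
Qed.

(** From 1 - x <= exp(- x), as 1 / (1 - x) <= 1 + x + 2 x^2 on this range. *)
Lemma expR_le_quadratic (x : R) : `|x| <= 2^-1 -> expR x <= 1 + x + 2 * x ^+ 2.
Proof.
rewrite ler_norml => /andP[x1 x2].
have h := expR_ge1Dx (- x); rewrite expRN in h.
have : expR x <= (1 - x)^-1.
  by rewrite -[expR x]invrK lef_pV2 // posrE ?invr_gt0 ?expR_gt0 //; lra.
move/le_trans; apply; rewrite -[leLHS]mul1r ler_pdivrMr; last lra.
have : 0 <= x ^+ 2 * (1 - 2 * x) by rewrite mulr_ge0 ?sqr_ge0 //; lra.
move=> h'; rewrite -subr_ge0.
by have -> : (1 + x + 2 * x ^+ 2) * (1 - x) - 1 = x ^+ 2 * (1 - 2 * x) by ring.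
Qed.

Lemma edge_prob_bounds c p q e : 0 <= q -> q <= p -> 0 <= edge_prob c p q e <= p.
Proof. by move=> q0 qp; rewrite /edge_prob; case: ifP => _; lra. Qed.

Lemma card_pairs_le : 2 * \sum_(e : {set T} | #|e| == 2%N) 1 <= n ^+ 2.
Proof.
rewrite -(sum_pairs_set2 (fun=> 1)).
apply: (@le_trans _ _ (\sum_(u : T) \sum_(v : T) 1)).
  by apply: ler_sum => u _; apply: ler_sum_subset.
by rewrite !sumr_const -[leLHS]mulr_natr expr2.
Qed.

(** Chernoff's method.  Each edge contributes at most 2 lam^2 p to the logarithm
    of the moment generating function, and there are at most n^2 / 2 pairs. *)
Lemma sbm_upper_tail c p q (w : {set T} -> R) (lam t : R) :
  0 <= q -> q <= p -> p <= 1 -> (forall e, `|w e| <= 1) -> 0 <= lam <= 2^-1 ->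
  \sum_(G | t < \sum_(e : {set T} | #|e| == 2%N)
                  w e * ((e \in edges G)%:R - edge_prob c p q e)) sbm c p q G
    <= expR (lam ^+ 2 * p * n ^+ 2 - lam * t).
Proof.
move=> q0 qp p1 w1 /andP[lam0 lam1].
pose phi e (b : bool) := expR (lam * (w e * (b%:R - edge_prob c p q e))).
have p0 : 0 <= p by lra.
have sbm0 G : 0 <= sbm c p q G by apply: sbm_ge0; lra.
apply: (@le_trans _ _ (\sum_G expR (- (lam * t)) *
    (sbm c p q G * \prod_(e : {set T} | #|e| == 2%N) phi e (e \in edges G)))).
  rewrite big_mkcond; apply: ler_sum => G _.
  rewrite -expR_sum -mulr_sumr mulrCA -expRD; case: ifP => [tS|_]; last first.
    by rewrite mulr_ge0 // expR_ge0.
  rewrite -[leLHS]mulr1 ler_wpM2l // -[leLHS]expR0 ler_expR addrC -mulrBr.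
  by rewrite mulr_ge0 // subr_ge0 ltW.
rewrite -mulr_sumr sbm_expect_prod addrC expRD ler_wpM2l ?expR_ge0 //.
apply: (@le_trans _ _ (\prod_(e : {set T} | #|e| == 2%N) expR (2 * lam ^+ 2 * p))).
  apply: ler_prod => e _; set P := edge_prob c p q e.
  have /andP[P0 Pp] : 0 <= P <= p by apply: edge_prob_bounds.
  rewrite /phi -/P; apply/andP; split.
    by rewrite addr_ge0 // mulr_ge0 ?expR_ge0 //; lra.
  have -> : P * expR (lam * (w e * (true%:R - P))) +
      (1 - P) * expR (lam * (w e * (false%:R - P))) =
      expR (- (lam * w e * P)) * (1 + P * (expR (lam * w e) - 1)).
    rewrite [lam * (w e * (true%:R - P))](_ : _ = - (lam * w e * P) + lam * w e);
      last first.
      by rewrite /= mulr1n; ring.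
    rewrite [lam * (w e * (false%:R - P))](_ : _ = - (lam * w e * P)); last first.
      by rewrite /= mulr0n; ring.
    by rewrite expRD; ring.
  apply: le_trans (ler_wpM2l (expR_ge0 _) (expR_ge1Dx _)) _.
  rewrite -expRD ler_expR.
  have lw : `|lam * w e| <= lam.
    by rewrite normrM ger0_norm // -[leRHS]mulr1 ler_wpM2l.
  have hq : expR (lam * w e) <= 1 + lam * w e + 2 * (lam * w e) ^+ 2.
    by apply: expR_le_quadratic; apply: le_trans lw _.
  have sq : (lam * w e) ^+ 2 <= lam ^+ 2.
    by rewrite -[(lam * w e) ^+ 2]real_normK ?num_real // lerXn2r ?nnegrE.
  have h1 : P * (expR (lam * w e) - 1) <= P * (lam * w e + 2 * lam ^+ 2).
    by rewrite ler_wpM2l //; lra.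
  have h2 : P * (2 * lam ^+ 2) <= p * (2 * lam ^+ 2).
    by rewrite ler_wpM2r // mulr_ge0 // sqr_ge0.
  move: h1 h2; rewrite mulrDr; lra.
rewrite -expR_sum ler_expR.
have -> : \sum_(e : {set T} | #|e| == 2%N) (2 * lam ^+ 2 * p) =
    lam ^+ 2 * p * (2 * \sum_(e : {set T} | #|e| == 2%N) 1).
  by rewrite mulrA mulr_sumr; apply: eq_bigr => e _; ring.
by rewrite ler_wpM2l ?card_pairs_le // mulr_ge0 // sqr_ge0.
Qed.

Lemma edge_prob_pair c p q u v : edge_prob c p q [set u; v] = pair_prob c p q u v.
Proof.
rewrite /edge_prob /pair_prob; congr (if _ then _ else _).
apply/existsP/eqP => [[i]|E].
  by rewrite subUset !sub1set !inE => /andP[/eqP-> /eqP->].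
by exists (c u); rewrite subUset !sub1set !inE E eqxx.
Qed.

Lemma sign_form_edges c p q G (x : {ffun T -> bool}) :
  \sum_u \sum_v (-1) ^+ x u * (-1) ^+ x v * noise c p q G u v =
  2 * \sum_(e : {set T} | #|e| == 2%N)
    (\prod_(u in e) (-1) ^+ x u) * ((e \in edges G)%:R - edge_prob c p q e).
Proof.
rewrite -sum_pairs_set2; apply: eq_bigr => u _; rewrite [RHS]big_mkcond.
apply: eq_bigr => v _; have [<-|uv] /= := eqVneq u v.
  by rewrite noise_diag mulr0.
rewrite /noise uv mul1r edge_prob_pair /adj; congr (_ * _).
by rewrite big_setU1 ?inE // big_set1.
Qed.

(** Union bound over 2 * 2^n signed forms.  With lam = eps / 4 the Chernoff
    exponent is eps^2 n^2 p / 16 >= 2 n, so the total is at most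
    2 * 2^n * exp(- 2 n) <= 2 exp(- n) <= 2 / n. *)
Lemma high_discrepancy_prob c p q eps :
  0 <= q -> q <= p -> p <= 1 -> 0 < eps <= 1 -> 0 < n -> 32 <= eps ^+ 2 * (n * p) ->
  \sum_(G | ~~ low_discrepancy c p q G (eps * n ^+ 2 * p)) sbm c p q G <= 2 / n.
Proof.
move=> q0 qp p1 /andP[eps0 eps1] n0 np.
have sbm0 G : 0 <= sbm c p q G by apply: sbm_ge0; lra.
(* The extra boolean is a global sign, so that upper tails suffice. *)
pose w (j : {ffun T -> bool} * bool) (e : {set T}) : R :=
  (-1) ^+ j.2 * \prod_(u in e) (-1) ^+ j.1 u.
pose S j G := \sum_(e : {set T} | #|e| == 2%N)
  w j e * ((e \in edges G)%:R - edge_prob c p q e).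
have w1 j e : `|w j e| <= 1.
  rewrite /w normrM normr_sign mul1r normr_prod.
  by rewrite big1 // => u _; rewrite normr_sign.
have tail j : \sum_(G | eps * n ^+ 2 * p / 2 < S j G) sbm c p q G <= expR (- (2 * n)).
  apply: le_trans (sbm_upper_tail c (lam := eps / 4) _ q0 qp p1 (w1 j) _) _.
    by apply/andP; split; lra.
  rewrite ler_expR.
  have : 32 * n <= eps ^+ 2 * (n * p) * n by rewrite ler_pM2r.
  rewrite -subr_ge0 => h; rewrite -subr_ge0.
  set y := (X in 0 <= X).
  have -> : y = (eps ^+ 2 * (n * p) * n - 32 * n) / 16 by rewrite /y; field.
  by rewrite divr_ge0.
apply: (@le_trans _ _ (\sum_(G | [exists j, eps * n ^+ 2 * p / 2 < S j G]) sbm c p q G)).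
  apply: ler_sum_subset => // G /forallPn[x].
  rewrite sign_form_edges -ltNge => h.
  set Z := \sum_(e | _) _ in h.
  have SE b : S (x, b) G = (-1) ^+ b * Z.
    by rewrite /S /Z mulr_sumr; apply: eq_bigr => e _; rewrite /w mulrA.
  apply/existsP; exists (x, Z < 0); rewrite SE.
  move: h; have [Z0|Z0] := ltP Z 0.
    by rewrite ltr0_norm ?pmulr_rlt0 // expr1; lra.
  by rewrite ger0_norm ?pmulr_rge0 // expr0; lra.
apply: le_trans (sum_exists_le _ sbm0) _.
apply: le_trans (ler_sum _ (fun j _ => tail j)) _.
rewrite sumr_const card_prod card_ffun card_bool -[leLHS]mulr_natl natrM natrX.
have h2 : 2 ^+ #|T| <= expR n.
  rewrite -[n]mulr1 expRM_natl lerXn2r ?nnegrE ?expR_ge0 //.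
  by have := expR_ge1Dx (1 : R); lra.
apply: (@le_trans _ _ (expR n * 2 * expR (- (2 * n)))).
  by rewrite ler_wpM2r ?expR_ge0 // ler_wpM2r.
have -> : expR n * 2 * expR (- (2 * n)) = 2 * expR (- n).
  have -> : - (2 * n) = - n + - n by ring.
  by rewrite expRD !expRN; field; rewrite gt_eqF ?expR_gt0.
rewrite ler_wpM2l // expRN lef_pV2 ?posrE ?expR_gt0 //.
by have := expR_ge1Dx n; lra.
Qed.

End Chernoff.

(** * Block sizes *)

Section RandomBlocks.
Variables (R : realType) (T : finType) (k : nat).
Hypothesis k_gt0 : (0 < k)%N.
Local Notation n := (#|T|%:R : R).
Local Notation kR := (k%:R : R).

Let kR_gt0 : 0 < kR. Proof. by rewrite ltr0n. Qed.

Let dev (i j : 'I_k) : R := (j == i)%:R - kR^-1.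

(** Distinct vertices choose independently and each deviation has mean zero. *)
Lemma sum_ffun_dev2 i (u v : T) :
  \sum_(c : {ffun T -> 'I_k}) dev i (c u) * dev i (c v) <= (u == v)%:R * kR ^+ #|T|.
Proof.
have [->|uv] := eqVneq u v.
  rewrite mul1r; have -> : kR ^+ #|T| = \sum_(c : {ffun T -> 'I_k}) 1.
    by rewrite sumr_const card_ffun card_ord natrX.
  apply: ler_sum => c _; rewrite -expr2.
  have kV0 : 0 < kR^-1 by rewrite invr_gt0.
  have kV1 : kR^-1 <= 1 by rewrite invf_le1 // ler1n.
  rewrite -[leRHS](expr1n _ 2) -[leLHS]real_normK ?num_real // lerXn2r ?nnegrE //.
  by rewrite ler_norml /dev; case: eqP => _ /=; rewrite ?mulr1n ?mulr0n;
    apply/andP; split; lra.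
rewrite mul0r le_eqVlt; apply/orP; left; apply/eqP.
pose F w j : R := if (w == u) || (w == v) then dev i j else 1.
transitivity (\prod_w \sum_j F w j).
  rewrite bigA_distr_bigA; apply: eq_bigr => c _.
  rewrite (bigD1 u) //= (bigD1 v) 1?eq_sym //= big1 => [|w /andP[wu wv]].
    by rewrite /F !eqxx orbT mulr1.
  by rewrite /F (negbTE wu) (negbTE wv).
rewrite (bigD1 u) //= [X in X * _](_ : _ = 0) ?mul0r //.
rewrite /F eqxx /= /dev sumrB (bigD1 i) //= eqxx big1 => [|j /negbTE-> //].
by rewrite sumr_const card_ord -[_ *+ k]mulr_natl divff ?gt_eqF //= mulr1n; lra.
Qed.

(** Chebyshev's inequality for each of the k block sizes, whose variance is at
    most n. *)
Lemma unbalanced_prob (eps : R) : 0 < eps -> 0 < n ->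
  \sum_(c : {ffun T -> 'I_k} | ~~ near_balanced c eps) \prod_(v : T) kR^-1
    <= kR / eps ^+ 2 / n.
Proof.
move=> eps0 n0.
have m_ge0 (c : {ffun T -> 'I_k}) : 0 <= \prod_(v : T) kR^-1.
  by apply: prodr_ge0 => v _; rewrite invr_ge0 ltW.
pose D (c : {ffun T -> 'I_k}) i : R := #|block c i|%:R - n / kR.
apply: (@le_trans _ _ (\sum_(c : {ffun T -> 'I_k} |
    [exists i, eps * n < `|D c i|]) \prod_(v : T) kR^-1)).
  apply: ler_sum_subset => // c /forallPn[i h]; apply/existsP; exists i.
  by rewrite ltNge.
apply: le_trans (sum_exists_le _ m_ge0) _.
have en0 : 0 < (eps * n) ^+ 2 by rewrite exprn_gt0 // mulr_gt0.
have -> : kR / eps ^+ 2 / n = \sum_(i < k) n / (eps * n) ^+ 2.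
  rewrite sumr_const card_ord -[RHS]mulr_natl; field.
  by rewrite !gt_eqF.
apply: ler_sum => i _; rewrite ler_pdivlMr // mulr_suml.
apply: (@le_trans _ _ (\sum_(c : {ffun T -> 'I_k}) kR ^- #|T| * D c i ^+ 2)).
  rewrite big_mkcond; apply: ler_sum => c _; rewrite prodr_const exprVn.
  have kn0 : 0 <= kR ^- #|T| by rewrite invr_ge0 exprn_ge0 // ltW.
  case: ifP => [h|_]; last by rewrite mulr_ge0 // sqr_ge0.
  rewrite ler_wpM2l // -[leRHS]real_normK ?num_real // lerXn2r ?nnegrE //.
    by rewrite mulr_ge0 ?(ltW n0) // ltW.
  exact: ltW.
have DE c : D c i ^+ 2 = \sum_u \sum_v dev i (c u) * dev i (c v).
  have -> : D c i = \sum_u dev i (c u).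
    rewrite /D /dev sumrB sumr_const -[kR^-1 *+ _]mulr_natl; congr (_ - _).
    rewrite -sum1_card natr_sum big_mkcond; apply: eq_bigr => u _.
    by rewrite inE; case: ifP.
  by rewrite expr2 mulr_suml; apply: eq_bigr => u _; rewrite mulr_sumr.
rewrite -mulr_sumr ler_pdivrMl ?exprn_gt0 //.
under eq_bigr => c _ do rewrite DE.
rewrite exchange_big /=.
apply: (@le_trans _ _ (\sum_(u : T) \sum_(v : T) (u == v)%:R * kR ^+ #|T|)).
  apply: ler_sum => u _; rewrite exchange_big /=.
  by apply: ler_sum => v _; apply: sum_ffun_dev2.
under eq_bigr => u _.
  rewrite (bigD1 u) //= eqxx mul1r big1 ?addr0; last first.
    by move=> v; rewrite eq_sym => /negbTE ->; rewrite mul0r.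
  over.
by rewrite sumr_const -[leLHS]mulr_natr.
Qed.

Lemma near_balanced_of_balanced (c : {ffun T -> 'I_k}) (eps : R) :
  balanced c -> 1 <= eps * n -> near_balanced c eps.
Proof.
move=> bal epsn; apply/forallP => i; apply: le_trans epsn.
have h : (#|T| <= k * #|block c i| + k)%N /\ (k * #|block c i| <= #|T| + k)%N.
  have h1 := divn_eq #|T| k; have h2 := ltn_pmod #|T| k_gt0.
  have h3 := divn_eq (#|T| + k.-1) k; have h4 := ltn_pmod (#|T| + k.-1) k_gt0.
  case: (bal i) => ->; nia.
have [] := h; rewrite -!(ler_nat R) !natrD !natrM => a b.
have -> : #|block c i|%:R - n / kR = (kR * #|block c i|%:R - n) / kR.
  by field; rewrite gt_eqF.
rewrite normrM normfV (gtr0_norm kR_gt0) ler_pdivrMr // mul1r ler_norml.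
by apply/andP; split; lra.
Qed.

End RandomBlocks.

(** * Convergence in probability *)

Local Open Scope classical_set_scope.

Lemma whp_approx_of_bad_le (R : realType) (Omega : nat -> finType)
    (mu X : forall n, Omega n -> R) (a : nat -> R) :
  (forall n w, 0 <= mu n w) -> (forall n, \sum_w mu n w = 1) ->
  (forall delta : R, 0 < delta -> exists C : R, \forall n \near \oo,
    \sum_(w : Omega n | ~~ (`|X n w - a n| <= delta)) mu n w <= C / n%:R) ->
  whp_approx mu X a.
Proof.
move=> mu0 mu1 H delta delta0; have [C HC] := H _ delta0.
apply/cvgrPdist_le => e e0; near=> n.
have good : 1 - \sum_(w : Omega n | `|X n w - a n| <= delta) mu n w =
    \sum_(w : Omega n | ~~ (`|X n w - a n| <= delta)) mu n w.
  apply/eqP; rewrite subr_eq addrC; apply/eqP; rewrite -(mu1 n).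
  exact: (bigID (fun w => `|X n w - a n| <= delta)).
rewrite good ger0_norm; last by apply: sumr_ge0.
apply: (@le_trans _ _ (C / n%:R)); first by near: n.
have n0 : 0 < n%:R :> R by rewrite ltr0n; near: n; exact: nbhs_infty_gt.
rewrite ler_pdivrMr // mulrC -ler_pdivrMr //; near: n.
exact: nbhs_infty_ger.
Unshelve. all: by end_near. Qed.

(** The modularity and the planted score both satisfy the hypothesis X_near below,
    so the passage from the deterministic estimates to probabilities is made
    once, for an arbitrary statistic X. *)
Section Transfer.
Variables (R : realType) (k : nat) (p q : nat -> R).
Hypothesis k_gt0 : (0 < k)%N.
Hypothesis pq_bounds : forall n, 0 <= q n /\ q n <= p n /\ p n <= 1.
Hypothesis np_infty : (fun n => n%:R * p n) @ \oo --> +oo.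
Variables (X : forall n, {ffun 'I_n -> 'I_k} -> sgraph 'I_n -> R) (a : nat -> R).
Hypothesis X_near : forall n (c : {ffun 'I_n -> 'I_k}) G (eps : R), 0 < p n ->
  low_discrepancy c (p n) (q n) G (eps * #|'I_n|%:R ^+ 2 * p n) ->
  near_balanced c eps -> 1 <= eps * #|'I_n|%:R -> 8 * k%:R * eps <= 1 ->
  `|X c G - a n| <= 33 * k%:R * eps.

Let sbm0 n (c : {ffun 'I_n -> 'I_k}) G : 0 <= sbm c (p n) (q n) G.
Proof. by have [? [? ?]] := pq_bounds n; apply: sbm_ge0; lra. Qed.

Let eventually_large (delta : R) : 0 < delta -> exists2 eps : R,
  [/\ 0 < eps, eps <= 1, 8 * k%:R * eps <= 1 & 33 * k%:R * eps <= delta] &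
  \forall n \near \oo, [/\ 0 < #|'I_n|%:R :> R, 0 < p n, 1 <= eps * #|'I_n|%:R
    & 32 <= eps ^+ 2 * (#|'I_n|%:R * p n)].
Proof.
move=> delta0; have k1 : 1 <= k%:R :> R by rewrite ler1n.
(* 33 k eps <= delta is the aim, and the minimum with 1 gives 8 k eps <= 1. *)
exists (Num.min 1 delta / (33 * k%:R)).
  have k33 : 0 < 33 * k%:R :> R by lra.
  have m0 : 0 < Num.min 1 delta by rewrite lt_min ltr01.
  have m1 : Num.min 1 delta <= 1 by rewrite ge_min lexx.
  split.
  - exact: divr_gt0.
  - by rewrite ler_pdivrMr //; lra.
  - by rewrite mulrA ler_pdivrMr // mul1r mulrC; nra.
  - by rewrite mulrC divfK ?gt_eqF // ge_min lexx orbT.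
set eps := _ / _; have eps0 : 0 < eps.
  by rewrite divr_gt0 // ?lt_min ?ltr01 //; lra.
near=> n; rewrite card_ord.
have n0 : 0 < n%:R :> R by rewrite ltr0n; near: n; exact: nbhs_infty_gt.
have big : 32 / eps ^+ 2 <= n%:R * p n.
  by near: n; move/cvgryPge : np_infty; apply.
have p0 : 0 < p n.
  by rewrite -(pmulr_rgt0 _ n0) (lt_le_trans _ big) // divr_gt0 // exprn_gt0.
split=> //.
  rewrite mulrC -ler_pdivrMr //; near: n; exact: nbhs_infty_ger.
by rewrite mulrC -ler_pdivrMr // exprn_gt0.
Unshelve. all: by end_near. Qed.

Lemma whp_fixed_blocks (c : forall n, {ffun 'I_n -> 'I_k}) :
  (forall n, balanced (c n)) ->
  whp_approx (Omega := fun n => sgraph 'I_n)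
    (fun n => sbm (c n) (p n) (q n)) (fun n G => X (c n) G) a.
Proof.
move=> bal; apply: whp_approx_of_bad_le => [n G|n|delta delta0].
- exact: sbm0.
- exact: sbm_sum1.
have [eps [e0 e1 e8 e33] large] := eventually_large delta0.
exists 2; near=> n.
have [n0 p0 en np] : [/\ 0 < #|'I_n|%:R :> R, 0 < p n, 1 <= eps * #|'I_n|%:R
    & 32 <= eps ^+ 2 * (#|'I_n|%:R * p n)] by near: n.
have [q0 [qp p1]] := pq_bounds n.
apply: le_trans (_ : _ <= 2 / #|'I_n|%:R) _; last by rewrite card_ord.
apply: le_trans (high_discrepancy_prob (c n) q0 qp p1 (_ : 0 < eps <= 1) n0 np);
  last by rewrite e0.
apply: ler_sum_subset => [G|G]; first exact: sbm0.
apply: contra => low; apply: le_trans e33.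
by apply: X_near => //; exact: near_balanced_of_balanced.
Unshelve. all: by end_near. Qed.

Lemma whp_random_blocks :
  whp_approx (Omega := fun n => ({ffun 'I_n -> 'I_k} * sgraph 'I_n)%type)
    (fun n => sbm_unif (p n) (q n)) (fun n cG => X cG.1 cG.2) a.
Proof.
have kV0 : 0 <= k%:R^-1 :> R by rewrite invr_ge0.
have unif0 n cG : 0 <= sbm_unif (k := k) (T := 'I_n) (p n) (q n) cG.
  by apply: mulr_ge0; [apply: prodr_ge0 | apply: sbm0].
apply: whp_approx_of_bad_le => [n G|n|delta delta0].
- exact: unif0.
- exact: sbm_unif_sum1.
have [eps [e0 e1 e8 e33] large] := eventually_large delta0.
exists (k%:R / eps ^+ 2 + 2); near=> n.
have [n0 p0 en np] : [/\ 0 < #|'I_n|%:R :> R, 0 < p n, 1 <= eps * #|'I_n|%:R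
    & 32 <= eps ^+ 2 * (#|'I_n|%:R * p n)] by near: n.
have [q0 [qp p1]] := pq_bounds n.
pose low (cG : {ffun 'I_n -> 'I_k} * sgraph 'I_n) :=
  low_discrepancy cG.1 (p n) (q n) cG.2 (eps * #|'I_n|%:R ^+ 2 * p n).
pose bad (b : bool) (cG : {ffun 'I_n -> 'I_k} * sgraph 'I_n) :=
  if b then ~~ low cG else ~~ near_balanced cG.1 eps.
apply: (@le_trans _ _ (\sum_(cG | [exists b, bad b cG]) sbm_unif (p n) (q n) cG)).
  apply: ler_sum_subset => [cG|cG]; first exact: unif0.
  apply: contraNT => /existsPn h; apply: le_trans e33.
  have := h true; have := h false; rewrite /= !negbK => nearc lowG.
  exact: X_near.
apply: le_trans (sum_exists_le bad (unif0 n)) _.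
rewrite big_bool /= mulrDl [leRHS]addrC; apply: lerD.
  rewrite -(pair_big_dep xpredT (fun c G => ~~ low (c, G))
    (fun c G => sbm_unif (p n) (q n) (c, G))) /=.
  apply: (@le_trans _ _ (\sum_(c : {ffun 'I_n -> 'I_k})
      (\prod_(v : 'I_n) k%:R^-1) * (2 / #|'I_n|%:R))).
    apply: ler_sum => c _; rewrite -mulr_sumr ler_wpM2l ?prodr_ge0 //.
    by apply: high_discrepancy_prob => //; rewrite e0.
  rewrite -mulr_suml sumr_const prodr_const card_ffun !card_ord.
  rewrite -[X in X * _]mulr_natl natrX -exprMn divff ?expr1n ?mul1r //.
  by rewrite pnatr_eq0 -lt0n.
have -> : \sum_(cG : {ffun 'I_n -> 'I_k} * sgraph 'I_n | ~~ near_balanced cG.1 eps)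
      sbm_unif (p n) (q n) cG =
    \sum_(c : {ffun 'I_n -> 'I_k} | ~~ near_balanced c eps)
      \sum_(G : sgraph 'I_n) sbm_unif (p n) (q n) (c, G).
  by rewrite pair_big_dep; apply: eq_big => [[c G]|[c G] _] //=; rewrite andbT.
under eq_bigr => c _ do rewrite -mulr_sumr sbm_sum1 mulr1.
apply: le_trans (unbalanced_prob k_gt0 e0 n0) _.
by rewrite card_ord.
Unshelve. all: by end_near. Qed.

End Transfer.

Theorem theorem2p1 (R : realType) (k : nat) (p q : nat -> R)
    (k_ge2 : (2 <= k)%N)
    (pq_bounds : forall n, 0 <= q n /\ q n <= p n /\ p n <= 1)
    (np_infty : (fun n => n%:R * p n) @ \oo --> +oo) :
  let a := fun n =>
    (p n - q n) * (1 - k%:R^-1) / (p n + (k%:R - 1) * q n) in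
  (forall c : forall n, {ffun 'I_n -> 'I_k}, (forall n, balanced (c n)) ->
     whp_approx (Omega := fun n => sgraph 'I_n)
       (fun n => sbm (c n) (p n) (q n))
       (fun n G => modularity R G) a /\
     whp_approx (Omega := fun n => sgraph 'I_n)
       (fun n => sbm (c n) (p n) (q n))
       (fun n G => mod_score R G (planted (c n))) a) /\
  (whp_approx (Omega := fun n => ({ffun 'I_n -> 'I_k} * sgraph 'I_n)%type)
     (fun n => sbm_unif (p n) (q n))
     (fun n cG => modularity R cG.2) a /\
   whp_approx (Omega := fun n => ({ffun 'I_n -> 'I_k} * sgraph 'I_n)%type)
     (fun n => sbm_unif (p n) (q n))
     (fun n cG => mod_score R cG.2 (planted cG.1)) a).
Proof.
move=> a; have k_gt0 : (0 < k)%N by apply: ltnW.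
have mod_near n (c : {ffun 'I_n -> 'I_k}) G (eps : R) : 0 < p n ->
    low_discrepancy c (p n) (q n) G (eps * #|'I_n|%:R ^+ 2 * p n) ->
    near_balanced c eps -> 1 <= eps * #|'I_n|%:R -> 8 * k%:R * eps <= 1 ->
    `|modularity R G - a n| <= 33 * k%:R * eps.
  have [q0 [qp _]] := pq_bounds n => p0 low nearc en eps8.
  exact: (modularity_near k_gt0 p0 q0 qp low nearc en eps8).
have planted_near n (c : {ffun 'I_n -> 'I_k}) G (eps : R) : 0 < p n ->
    low_discrepancy c (p n) (q n) G (eps * #|'I_n|%:R ^+ 2 * p n) ->
    near_balanced c eps -> 1 <= eps * #|'I_n|%:R -> 8 * k%:R * eps <= 1 ->
    `|mod_score R G (planted c) - a n| <= 33 * k%:R * eps.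
  have [q0 [qp _]] := pq_bounds n => p0 low nearc en eps8.
  exact: (mod_score_planted_near k_gt0 p0 q0 qp low nearc en eps8).
split=> [c bal|]; split.
- exact: (whp_fixed_blocks k_gt0 pq_bounds np_infty mod_near bal).
- exact: (whp_fixed_blocks k_gt0 pq_bounds np_infty planted_near bal).
- exact: (whp_random_blocks k_gt0 pq_bounds np_infty mod_near).
- exact: (whp_random_blocks k_gt0 pq_bounds np_infty planted_near).
Qed.
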